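(* For $|q|<1$, the functions $\mathcal{P}$, $e$, $\mathcal{Q}$ satisfy $$q\frac{d\mathcal{P}}{dq}=\frac{\mathcal{P}^2-\mathcal{Q}}{4}\qquad\text{and}\qquad q\frac{d\mathcal{Q}}{dq}=\mathcal{P}\mathcal{Q}-e\mathcal{Q}.$$
   Context: For $|q|<1$ define $$\mathcal{P}(q)=1+8\sum_{n=1}^{\infty}\frac{(-1)^{n-1}nq^n}{1-q^n},\quad e(q)=1+24\sum_{n=1}^{\infty}\frac{nq^n}{1+q^n},\quad \mathcal{Q}(q)=1-16\sum_{n=1}^{\infty}\frac{(-1)^{n-1}n^3q^n}{1-q^n}.$$ *)

(* Defs.v *)
From Stdlib Require Import Reals.
From Coquelicot Require Import Coquelicot.

Open Scope R_scope.
Open Scope C_scope.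

(* Coquelicot's total [Series] is real-valued only; a complex series is summed
   componentwise.  [is_CSeries_unique] below: this is the sum whenever the
   series converges in C. *)
Definition CSeries (a : nat -> C) : C :=
  (Series (fun k => Re (a k)), Series (fun k => Im (a k))).

(* Summation starts at index 1: [a 0] is dropped. *)
Definition CSeries1 (a : nat -> C) : C := CSeries (fun k => a (S k)).

Definition calP (q : C) : C :=
  1 + 8 * CSeries1 (fun n => (-1) ^ (n - 1) * INR n * q ^ n / (1 - q ^ n)).

Definition calE (q : C) : C :=
  1 + 24 * CSeries1 (fun n => INR n * q ^ n / (1 + q ^ n)).

Definition calQ (q : C) : C :=
  1 - 16 * CSeries1 (fun n => (-1) ^ (n - 1) * INR n ^ 3 * q ^ n / (1 - q ^ n)).

Lemma sum_n_Re_Im (a : nat -> C) (n : nat) :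
  sum_n (G := C_AbelianMonoid) a n =
  (sum_n (fun k => Re (a k)) n, sum_n (fun k => Im (a k)) n).
Proof.
  induction n as [|n IH].
  - rewrite !sum_O. now destruct (a O).
  - rewrite !sum_Sn, IH. reflexivity.
Qed.

Lemma is_CSeries_unique (a : nat -> C) (l : C) :
  is_series (K := C_AbsRing) (V := C_NormedModule) a l -> CSeries a = l.
Proof.
  intros H. unfold CSeries.
  rewrite (surjective_pairing l).
  f_equal; apply is_series_unique; intros P [eps HP].
  - assert (L : locally (T := C_UniformSpace) l (fun z => P (fst z))).
    { exists eps. intros z Hz. apply HP, Hz. }
    specialize (H _ L). unfold filtermap in *.
    revert H. apply filter_imp. intros n Hn.
    exact (eq_ind _ P Hn _ (f_equal fst (sum_n_Re_Im a n))).
  - assert (L : locally (T := C_UniformSpace) l (fun z => P (snd z))).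
    { exists eps. intros z Hz. apply HP, Hz. }
    specialize (H _ L). unfold filtermap in *.
    revert H. apply filter_imp. intros n Hn.
    exact (eq_ind _ P Hn _ (f_equal snd (sum_n_Re_Im a n))).
Qed.

(* Main.v *)
Require Import Defs.
From Stdlib Require Import Reals.
From Coquelicot Require Import Coquelicot.
From Stdlib Require Import Lra Lia.

Open Scope R_scope.
Open Scope C_scope.

(* Put u_n = q^n/(1-q^n).  All three functions are Lambert series in the u_n
   (for e because q^n/(1+q^n) = u_n - 2 u_(2n)), and q du_n/dq = n (u_n + u_n^2).
   The products P^2 and (P - e) Q become double sums of T(a,b) u_a u_b, with
   symmetric T.  They are evaluated with u_a u_b = u_(a+b) (u_a + u_b + 1): if H
   is symmetric and T(a+b,b) = H(a+b,b) - H(a,b), then comparing the sums of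
   H(a,b) u_a u_b over a > b and over all (a,b) gives
     sum_(a,b) T(a,b) u_a u_b
       = sum_d ((sum_(0<b<d) H(d-b,b)) u_d + (T(d,d) - H(d,d)) u_d^2),
   which is a single Lambert series plus a derivative of one.  Suitable H exist
   for both products.  The identity is proved for partial sums, up to the sum of
   H(a,b) u_a u_b over a,b <= N < a+b, which tends to 0. *)

(** * Finite complex sums from index 1, the partial sums of [CSeries1] *)

Fixpoint csum (f : nat -> C) (n : nat) : C :=
  match n with O => 0 | S m => csum f m + f (S m) end.

Lemma csum_ext (f g : nat -> C) (n : nat) :
  (forall k, (1 <= k <= n)%nat -> f k = g k) -> csum f n = csum g n.
Proof.
  induction n as [|n IH]; intros H; [reflexivity|]; simpl.
  rewrite IH by (intros; apply H; lia). rewrite H by lia. reflexivity.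
Qed.

Lemma csum_plus (f g : nat -> C) (n : nat) :
  csum (fun k => f k + g k) n = csum f n + csum g n.
Proof. induction n as [|n IH]; simpl; [|rewrite IH]; ring. Qed.

Lemma csum_mult_l (c : C) (f : nat -> C) (n : nat) :
  csum (fun k => c * f k) n = c * csum f n.
Proof. induction n as [|n IH]; simpl; [|rewrite IH]; ring. Qed.

Lemma csum_mult (f g : nat -> C) (m n : nat) :
  csum (fun b => csum (fun a => f a * g b) m) n = csum f m * csum g n.
Proof.
  rewrite <- csum_mult_l. apply csum_ext. intros b _.
  rewrite Cmult_comm, <- csum_mult_l. apply csum_ext. intros a _. ring.
Qed.

Lemma csum_split (f : nat -> C) (m n : nat) :
  csum f (m + n) = csum f m + csum (fun k => f (m + k)%nat) n.
Proof.
  induction n as [|n IH]; simpl.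
  - rewrite Nat.add_0_r. ring.
  - rewrite Nat.add_succ_r. simpl. rewrite IH. ring.
Qed.

Lemma csum_shift (f : nat -> C) (n : nat) :
  csum f (S n) = f 1%nat + csum (fun k => f (S k)) n.
Proof.
  change (csum f (1 + n) = f 1%nat + csum (fun k => f (1 + k)%nat) n).
  rewrite csum_split. simpl. ring.
Qed.

Lemma csum_rev (f : nat -> C) (n : nat) :
  csum (fun k => f (S n - k)%nat) n = csum f n.
Proof.
  induction n as [|n IH]; [reflexivity|].
  rewrite csum_shift.
  rewrite (csum_ext _ (fun k => f (S n - k)%nat)) by reflexivity.
  rewrite IH. simpl. ring.
Qed.

Lemma Cmod_csum_le (f : nat -> C) (B : R) (n : nat) :
  (forall k, (1 <= k <= n)%nat -> (Cmod (f k) <= B)%R) ->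
  (Cmod (csum f n) <= INR n * B)%R.
Proof.
  induction n as [|n IH]; intros H.
  - simpl. rewrite Cmod_0. lra.
  - rewrite S_INR. simpl.
    eapply Rle_trans; [apply Cmod_triangle|].
    assert (H1 := H (S n) ltac:(lia)).
    assert (H2 := IH ltac:(intros; apply H; lia)). lra.
Qed.

(** * Double sums over a square and a triangle, and the descent *)

Definition square_sum (K : nat -> nat -> C) (n : nat) : C :=
  csum (fun b => csum (fun a => K a b) n) n.

(** The pairs with [a + b <= n]: the map [(a, b) -> (a + b, b)] carries them to the pairs of the
    square whose first entry exceeds the second. *)
Definition triangle_sum (K : nat -> nat -> C) (n : nat) : C :=
  csum (fun b => csum (fun a => K a b) (n - b)) n.

Lemma square_sum_S (K : nat -> nat -> C) (n : nat) :
  (forall a b, K a b = K b a) ->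
  square_sum K (S n) =
  square_sum K n + 2 * csum (fun b => K (S n) b) n + K (S n) (S n).
Proof.
  intros HK. unfold square_sum. simpl. rewrite csum_plus.
  rewrite (csum_ext (fun a => K a (S n)) (fun b => K (S n) b)) by (intros; apply HK).
  change (csum (K (S n)) n) with (csum (fun b => K (S n) b) n). ring.
Qed.

Lemma triangle_sum_S (K : nat -> nat -> C) (n : nat) :
  triangle_sum K (S n) = triangle_sum K n + csum (fun b => K (S n - b)%nat b) n.
Proof.
  unfold triangle_sum. rewrite <- csum_plus.
  (* The outer index [S n] contributes the inner range [S n - S n], which is empty. *)
  change (csum (fun b => csum (fun a => K a b) (S n - b)) n
          + csum (fun a => K a (S n)) (n - n) =
          csum (fun b => csum (fun a => K a b) (n - b) + K (S n - b)%nat b) n).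
  rewrite Nat.sub_diag, Cplus_0_r. apply csum_ext. intros b Hb.
  rewrite Nat.sub_succ_l by lia. reflexivity.
Qed.

(* Truncated form of the double-sum identity; the parenthesised difference is the
   part of the square lying beyond the antidiagonal [a + b = n]. *)
Lemma lambert_descent (u : nat -> C) (H T : nat -> nat -> R) :
  (forall a b, (1 <= a)%nat -> (1 <= b)%nat ->
     u a * u b = u (a + b)%nat * (u a + u b + 1)) ->
  (forall a b, H a b = H b a) ->
  (forall a b, T a b = T b a) ->
  (forall a b, (1 <= a)%nat -> (1 <= b)%nat ->
     T (a + b)%nat b = (H (a + b)%nat b - H a b)%R) ->
  forall n,
  square_sum (fun a b => T a b * (u a * u b)) n
  - (square_sum (fun a b => H a b * (u a * u b)) n
     - triangle_sum (fun a b => H a b * (u a * u b)) n)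
  = csum (fun d => csum (fun b => RtoC (H (d - b)%nat b)) (d - 1) * u d
                   + (T d d - H d d) * (u d * u d)) n.
Proof.
  intros Hu HH HT HTH n.
  induction n as [|n IH]; [unfold square_sum, triangle_sum; simpl; ring|].
  rewrite (square_sum_S (fun a b => T a b * (u a * u b)))
    by (intros a b; rewrite (HT a b); ring).
  rewrite (square_sum_S (fun a b => H a b * (u a * u b)))
    by (intros a b; rewrite (HH a b); ring).
  rewrite triangle_sum_S.
  change (csum ?f (S n)) with (csum f n + f (S n)). cbv beta.
  rewrite <- IH. rewrite Nat.sub_succ, Nat.sub_0_r.
  (* On the antidiagonal the product relation gives [u (S n)] times [u (S n - b) + u b + 1].
     Reversing [b] and using the symmetry of [H] makes the first two pieces equal, whence the factor
     2. *)
  assert (E : csum (fun b => H (S n - b)%nat b * (u (S n - b)%nat * u b)) n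
     = 2 * csum (fun b => H (S n - b)%nat b * (u (S n) * u b)) n
       + csum (fun b => RtoC (H (S n - b)%nat b)) n * u (S n)).
  { transitivity (csum (fun b => H (S n - b)%nat b * (u (S n) * u (S n - b)%nat)) n
       + csum (fun b => H (S n - b)%nat b * (u (S n) * u b)) n
       + csum (fun b => RtoC (H (S n - b)%nat b)) n * u (S n)).
    - rewrite (Cmult_comm _ (u (S n))), <- csum_mult_l, <- !csum_plus.
      apply csum_ext. intros b Hb. rewrite Hu by lia.
      replace (S n - b + b)%nat with (S n) by lia. ring.
    - rewrite <- (csum_rev (fun b => H (S n - b)%nat b * (u (S n) * u b)) n).
      rewrite (csum_ext (fun k => H (S n - (S n - k))%nat (S n - k)%nat
                                  * (u (S n) * u (S n - k)%nat))
                        (fun b => H (S n - b)%nat b * (u (S n) * u (S n - b)%nat)));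
        [ring|].
      intros b Hb. replace (S n - (S n - b))%nat with b by lia. now rewrite HH. }
  rewrite E.
  (* The relation between [T] and [H] at [a = S n - b], summed along the row [S n]. *)
  assert (E2 : csum (fun b => T (S n) b * (u (S n) * u b)) n
     = csum (fun b => H (S n) b * (u (S n) * u b)) n
       - csum (fun b => H (S n - b)%nat b * (u (S n) * u b)) n).
  { replace (csum (fun b => H (S n) b * (u (S n) * u b)) n) with
      (csum (fun b => T (S n) b * (u (S n) * u b)) n +
       csum (fun b => H (S n - b)%nat b * (u (S n) * u b)) n); [ring|].
    rewrite <- csum_plus. apply csum_ext. intros b Hb.
    assert (HTb := HTH (S n - b)%nat b ltac:(lia) ltac:(lia)).
    replace (S n - b + b)%nat with (S n) in HTb by lia.
    rewrite HTb, RtoC_minus. ring. }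
  rewrite E2. ring.
Qed.

(** * Alternating signs and the coefficient identities for the two products *)

Definition sgn (n : nat) : R := ((-1) ^ n)%R.

Lemma sgn_S (n : nat) : sgn (S n) = (- sgn n)%R.
Proof. unfold sgn. simpl. ring. Qed.

Lemma sgn_add (m n : nat) : sgn (m + n) = (sgn m * sgn n)%R.
Proof. apply pow_add. Qed.

(** Reduces each sign identity below to polynomial identities, one for each choice of parities. *)
Lemma sgn_cases (n : nat) : sgn n = 1%R \/ sgn n = (-1)%R.
Proof.
  induction n as [|n [IH|IH]]; [now left| |]; rewrite sgn_S, IH; [right|left]; ring.
Qed.

Lemma sgn_sub (m n : nat) : (n <= m)%nat -> sgn (m - n) = (sgn m * sgn n)%R.
Proof.
  intros Hnm. replace m with (m - n + n)%nat at 2 by lia. rewrite sgn_add.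
  destruct (sgn_cases n) as [E|E]; rewrite E; ring.
Qed.

(** Telescoping against a discrete antiderivative [F]. The step is asked only for [k < n], where the
    natural-number differences in the summands are exact. *)
Lemma csum_RtoC (f F : nat -> R) (n : nat) :
  F 0%nat = 0%R ->
  (forall k, (k < n)%nat -> F (S k) = (F k + f (S k))%R) ->
  csum (fun k => RtoC (f k)) n = RtoC (F n).
Proof.
  induction n as [|n IH]; intros H0 HS; simpl; [now rewrite H0|].
  rewrite IH by (auto; intros; apply HS; lia).
  rewrite HS by lia. now rewrite RtoC_plus.
Qed.

(** Four times the product of the [a]-th and [b]-th Lambert coefficients of [(calP - 1) / 8]. *)
Definition kernel2 (a b : nat) : R := (4 * (sgn a * INR a) * (sgn b * INR b))%R.

(* [f a + f b + f (a + b)] for [f x = (-1)^x x^2], while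
   [kernel2 a b = f (a + b) - f (a - b)]. *)
Definition potential2 (a b : nat) : R :=
  (sgn a * INR a ^ 2 + sgn b * INR b ^ 2 + sgn a * sgn b * (INR a + INR b) ^ 2)%R.

(** With [f x = (-1)^x x^2] both sides equal [f (a + 2 b) - f a]. *)
Lemma kernel2_potential2 (a b : nat) : kernel2 (a + b) b = (potential2 (a + b) b - potential2 a b)%R.
Proof.
  unfold kernel2, potential2. rewrite sgn_add, plus_INR.
  destruct (sgn_cases a) as [Ea|Ea], (sgn_cases b) as [Eb|Eb];
    rewrite Ea, Eb; ring.
Qed.

(** The cubic term yields the series of [calQ] and the linear one that of [calP]. The quadratic term
    has the coefficient of the diagonal defect [kernel2 d d - potential2 d d], so the two combine
    into a multiple of [u d + u d ^ 2], a derivative. *)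
Lemma potential2_antidiagonal (m : nat) :
  csum (fun b => RtoC (potential2 (S m - b) b)) m
  = RtoC (sgn (S m) * (INR (S m) ^ 3 - 2 * INR (S m) ^ 2 + INR (S m)))%R.
Proof.
  set (d := INR (S m)). set (s := sgn (S m)).
  (* Partial sum up to [k], with [d] and [s] fixed: the three groups come from [f b], [f d] and
     [f (d - b)], and the constant in the middle one makes the value at 0 vanish. *)
  rewrite (csum_RtoC _ (fun k =>
    sgn k * (INR k ^ 2 + INR k) / 2 + s * (d ^ 2 * INR k - (d ^ 2 - d) / 2)
    + s * sgn k * (d ^ 2 - 2 * d * INR k - d + INR k ^ 2 + INR k) / 2)%R).
  - f_equal. unfold s, d. rewrite !sgn_S, S_INR.
    destruct (sgn_cases m) as [E|E]; rewrite E; field.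
  - change (sgn 0) with 1%R. simpl. field.
  - intros k Hk. unfold potential2. rewrite sgn_sub, minus_INR by lia.
    fold s d. rewrite sgn_S, S_INR.
    unfold s. destruct (sgn_cases k) as [E|E], (sgn_cases (S m)) as [F|F];
    rewrite E, F; field.
Qed.

(** The coefficients [(3 - sgn n) n] of [calP - calE], up to the factor -4, times the coefficients
    [sgn n n^3] of [calQ], up to 16; symmetrised, as the descent requires. *)
Definition kernel4 (a b : nat) : R :=
  ((3 - sgn a) * INR a * (sgn b * INR b ^ 3)
   + (3 - sgn b) * INR b * (sgn a * INR a ^ 3))%R.

(* On each pair of parities of [a] and [b] this is a quartic form: the solution of
   the difference equation [kernel4_potential4], found by undetermined coefficients. *)
Definition potential4 (a b : nat) : R :=
  (sgn a * (1 + sgn b) / 4 * INR a ^ 4 + sgn b * (1 + sgn a) / 4 * INR b ^ 4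
   + sgn a * (3 - sgn b) / 2 * (INR a ^ 3 * INR b)
   + sgn b * (3 - sgn a) / 2 * (INR a * INR b ^ 3)
   + 3 / 2 * (sgn a + sgn b - sgn a * sgn b) * (INR a ^ 2 * INR b ^ 2))%R.

Lemma kernel4_potential4 (a b : nat) : kernel4 (a + b) b = (potential4 (a + b) b - potential4 a b)%R.
Proof.
  unfold kernel4, potential4. rewrite sgn_add, plus_INR.
  destruct (sgn_cases a) as [Ea|Ea], (sgn_cases b) as [Eb|Eb];
    rewrite Ea, Eb; field.
Qed.

(** The linear term reproduces the coefficients of [calP - calE]. The quartic term equals the
    diagonal defect of [kernel4] and [potential4], so together they form the derivative of the
    series of [calQ]. *)
Lemma potential4_antidiagonal (m : nat) :
  csum (fun b => RtoC (potential4 (S m - b) b)) m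
  = RtoC (- (3 - sgn (S m)) * INR (S m) / 8 - sgn (S m) * INR (S m) ^ 4 / 2)%R.
Proof.
  set (d := INR (S m)). set (s := sgn (S m)).
  (* Partial sum up to [k], one polynomial for each of the sign products [1], [sgn k], [s],
     [s * sgn k]. Inside it [m] denotes [INR k] and shadows the outer [m]. *)
  rewrite (csum_RtoC _ (fun k => let m := INR k in
   -3/16 * d
   + sgn k * (3/4*d^2*(m^2+m) - 3/4*d*m^3 - 9/8*d*m^2 + 3/16*d
              + 1/8*m^4 + 1/4*m^3 - 1/8*m)
   + s * (1/4*d^4*m - 1/8*d^4 - 3/4*d^3*(m^2+m) - 1/8*d^3
          + 1/2*d^2*m^3 + 3/4*d^2*m^2 + 1/4*d^2*m + 1/16*d)
   + s * sgn k * (1/8*d^4 + 1/4*d^3*m + 1/8*d^3 - 3/4*d^2*(m^2+m) + 1/4*d*m^3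
          + 3/8*d*m^2 - 1/16*d + 1/8*m^4 + 1/4*m^3 - 1/8*m))%R).
  - f_equal. cbv zeta. unfold s, d. rewrite !sgn_S, S_INR.
    destruct (sgn_cases m) as [E|E]; rewrite E; field.
  - change (sgn 0) with 1%R. simpl. field.
  - intros k Hk. cbv zeta. unfold potential4. rewrite sgn_sub, minus_INR by lia.
    fold s d. rewrite sgn_S, S_INR.
    unfold s. destruct (sgn_cases k) as [E|E], (sgn_cases (S m)) as [F|F];
    rewrite E, F; field.
Qed.

(** * Truncated forms of the two differential equations *)

(** For [u = lambert q] the limit is [4 A^2 = - B - A + 2 q A'], where [calP = 1 + 8 A] and
    [calQ = 1 - 16 B]: the first equation. *)
Lemma descent2 (u : nat -> C) :
  (forall a b, (1 <= a)%nat -> (1 <= b)%nat ->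
     u a * u b = u (a + b)%nat * (u a + u b + 1)) ->
  forall n,
  4 * (csum (fun k => RtoC (- sgn k * INR k)%R * u k) n
       * csum (fun k => RtoC (- sgn k * INR k)%R * u k) n)
  - (square_sum (fun a b => potential2 a b * (u a * u b)) n
     - triangle_sum (fun a b => potential2 a b * (u a * u b)) n)
  = - csum (fun k => RtoC (- sgn k * INR k ^ 3)%R * u k) n
    - csum (fun k => RtoC (- sgn k * INR k)%R * u k) n
    + 2 * csum (fun k => RtoC (INR k * (- sgn k * INR k))%R * (u k + u k * u k)) n.
Proof.
  intros Hu n.
  rewrite <- (csum_mult (fun k => RtoC (- sgn k * INR k)%R * u k)).
  rewrite <- csum_mult_l.
  rewrite (csum_ext _ (fun b => csum (fun a => kernel2 a b * (u a * u b)) n)).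
  2: { intros b _. rewrite <- csum_mult_l. apply csum_ext. intros a _.
       unfold kernel2. rewrite !RtoC_mult, !RtoC_opp. ring. }
  fold (square_sum (fun a b => kernel2 a b * (u a * u b)) n).
  rewrite (lambert_descent u potential2 kernel2 Hu).
  - match goal with |- _ = - ?x - ?y + RtoC 2 * ?z =>
      replace (- x - y + 2 * z) with (-1 * x + (-1) * y + 2 * z) by ring end.
    rewrite <- !csum_mult_l, <- !csum_plus. apply csum_ext.
    intros [|m] Hk; [lia|]. rewrite Nat.sub_succ, Nat.sub_0_r, potential2_antidiagonal.
    rewrite <- RtoC_minus.
    replace (kernel2 (S m) (S m) - potential2 (S m) (S m))%R
      with (- 2 * sgn (S m) * INR (S m) ^ 2)%R.
    + rewrite ?RtoC_mult, ?RtoC_plus, ?RtoC_minus, ?RtoC_opp, ?RtoC_mult, ?RtoC_pow.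
      ring.
    + unfold kernel2, potential2. destruct (sgn_cases (S m)) as [E|E]; rewrite E; ring.
  - intros. unfold potential2. ring.
  - intros. unfold kernel2. ring.
  - intros. apply kernel2_potential2.
Qed.

(** For [u = lambert q] the limit is [2 W B = W / 8 - q B' / 2], where [calP - calE = -4 W] and
    [calQ = 1 - 16 B]: the second equation. *)
Lemma descent4 (u : nat -> C) :
  (forall a b, (1 <= a)%nat -> (1 <= b)%nat ->
     u a * u b = u (a + b)%nat * (u a + u b + 1)) ->
  forall n,
  2 * (csum (fun k => RtoC ((3 + -1 * sgn k) * INR k)%R * u k) n
       * csum (fun k => RtoC (- sgn k * INR k ^ 3)%R * u k) n)
  + (square_sum (fun a b => potential4 a b * (u a * u b)) n
     - triangle_sum (fun a b => potential4 a b * (u a * u b)) n)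
  = 1 / 8 * csum (fun k => RtoC ((3 + -1 * sgn k) * INR k)%R * u k) n
    - 1 / 2 * csum (fun k => RtoC (INR k * (- sgn k * INR k ^ 3))%R * (u k + u k * u k)) n.
Proof.
  intros Hu n.
  set (A := csum (fun k => RtoC ((3 + -1 * sgn k) * INR k)%R * u k) n).
  set (B := csum (fun k => RtoC (- sgn k * INR k ^ 3)%R * u k) n).
  (* [kernel4] counts both orders of the product, and its factor [sgn b b^3] is opposite in sign to
     the coefficients of [B]. *)
  assert (E : square_sum (fun a b => kernel4 a b * (u a * u b)) n = -1 * (A * B) + (-1) * (B * A)).
  { unfold A, B. rewrite <- !csum_mult, <- !csum_mult_l, <- csum_plus.
    apply csum_ext. intros b _.
    rewrite <- !csum_mult_l, <- csum_plus. apply csum_ext. intros a _.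
    unfold kernel4. rewrite ?RtoC_plus, ?RtoC_mult, ?RtoC_minus, ?RtoC_plus, ?RtoC_opp, ?RtoC_mult. ring. }
  pose proof (lambert_descent u potential4 kernel4 Hu) as L.
  specialize (L ltac:(intros; unfold potential4; field) ltac:(intros; unfold kernel4; ring)
               ltac:(intros; apply kernel4_potential4) n).
  rewrite E in L.
  match type of L with _ = ?r =>
    transitivity (-1 * r); [rewrite <- L; ring|] end.
  clear L E.
  match goal with |- _ = ?x - RtoC 1 / RtoC 2 * ?y => replace (x - 1 / 2 * y) with (x + (-(1/2)) * y) by ring end.
  unfold A. rewrite <- !csum_mult_l, <- !csum_plus. apply csum_ext.
  intros [|m] Hk; [lia|]. rewrite Nat.sub_succ, Nat.sub_0_r, potential4_antidiagonal.
  rewrite <- RtoC_minus.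
  replace (kernel4 (S m) (S m) - potential4 (S m) (S m))%R
    with (- (sgn (S m) * INR (S m) ^ 4 / 2))%R.
  + unfold Rdiv. repeat rewrite ?RtoC_mult, ?RtoC_plus, ?RtoC_minus, ?RtoC_opp, ?RtoC_pow, ?RtoC_inv by lra.
    field.
  + unfold kernel4, potential4. destruct (sgn_cases (S m)) as [E|E]; rewrite E; field.
Qed.

(** * Limits of complex sequences and componentwise sums *)

(** Convergence is phrased through a real sequence, so that real limit theorems apply directly. *)
Definition Clim (s : nat -> C) (l : C) : Prop :=
  is_lim_seq (fun n => Cmod (s n - l)) 0.

Lemma is_lim_seq_0_le (s t : nat -> R) :
  (forall n, 0 <= s n <= t n)%R -> is_lim_seq t 0 -> is_lim_seq s 0.
Proof.
  intros H Ht. apply is_lim_seq_le_le with (fun _ => 0%R) t; auto.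
  apply is_lim_seq_const.
Qed.

Lemma Clim_of_le (s : nat -> C) (l : C) (t : nat -> R) :
  (forall n, Cmod (s n - l) <= t n)%R -> is_lim_seq t 0 -> Clim s l.
Proof.
  intros H. apply is_lim_seq_0_le. intros n. split; [apply Cmod_ge_0|apply H].
Qed.

Lemma Clim_ext (s t : nat -> C) (l : C) :
  (forall n, s n = t n) -> Clim s l -> Clim t l.
Proof. intros H. apply is_lim_seq_ext. intros n. now rewrite H. Qed.

Lemma Clim_const (c : C) : Clim (fun _ => c) c.
Proof.
  apply is_lim_seq_ext with (fun _ => 0%R); [|apply is_lim_seq_const].
  intros _. replace (c - c) with (RtoC 0) by ring. now rewrite Cmod_0.
Qed.

Lemma Clim_plus (s t : nat -> C) (l m : C) :
  Clim s l -> Clim t m -> Clim (fun n => s n + t n) (l + m).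
Proof.
  intros Hs Ht. apply Clim_of_le with (fun n => (Cmod (s n - l) + Cmod (t n - m))%R).
  - intros n. replace (s n + t n - (l + m)) with ((s n - l) + (t n - m)) by ring.
    apply Cmod_triangle.
  - replace (Finite 0) with (Finite (0 + 0)) by (f_equal; lra).
    now apply is_lim_seq_plus'.
Qed.

Lemma Clim_mult (s t : nat -> C) (l m : C) :
  Clim s l -> Clim t m -> Clim (fun n => s n * t n) (l * m).
Proof.
  intros Hs Ht.
  apply Clim_of_le with (fun n => (Cmod (s n - l) * Cmod (t n - m)
    + Cmod m * Cmod (s n - l) + Cmod l * Cmod (t n - m))%R).
  - intros n.
    replace (s n * t n - l * m)
      with ((s n - l) * (t n - m) + m * (s n - l) + l * (t n - m)) by ring.
    rewrite <- !Cmod_mult.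
    eapply Rle_trans; [apply Cmod_triangle|]. apply Rplus_le_compat_r, Cmod_triangle.
  - replace (Finite 0) with (Finite (0 * 0 + Cmod m * 0 + Cmod l * 0))
      by (f_equal; ring).
    repeat apply is_lim_seq_plus'; apply is_lim_seq_mult';
      auto using is_lim_seq_const.
Qed.

Lemma Clim_scal (c : C) (s : nat -> C) (l : C) :
  Clim s l -> Clim (fun n => c * s n) (c * l).
Proof. apply (Clim_mult (fun _ => c)), Clim_const. Qed.

Lemma Clim_Cmod_le (s : nat -> C) (l : C) (B : R) :
  Clim s l -> (forall n, Cmod (s n) <= B)%R -> (Cmod l <= B)%R.
Proof.
  intros Hs HB.
  change (Rbar_le (Cmod l) B).
  replace B with (0 + B)%R by ring.
  refine (is_lim_seq_le (fun _ => Cmod l) (fun n => Cmod (s n - l) + B)%R _ _ _ _ _).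
  - intros n. replace l with (- (s n - l) + s n) at 1 by ring.
    eapply Rle_trans; [apply Cmod_triangle|]. rewrite Cmod_opp. specialize (HB n). lra.
  - apply is_lim_seq_const.
  - apply is_lim_seq_plus'; [exact Hs|apply is_lim_seq_const].
Qed.

(** The zero sequence [s - s] tends to [l - m], whose modulus is therefore at most 0. *)
Lemma Clim_unique (s : nat -> C) (l m : C) : Clim s l -> Clim s m -> l = m.
Proof.
  intros Hl Hm. apply Ceq_minus, Cmod_eq_0, Rle_antisym; [|apply Cmod_ge_0].
  apply Clim_Cmod_le with (fun n => s n + -1 * s n).
  - replace (l - m) with (l + -1 * m) by ring.
    apply Clim_plus; auto using Clim_scal.
  - intros n. replace (s n + -1 * s n) with (RtoC 0) by ring. rewrite Cmod_0. lra.
Qed.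

Lemma CSeries1_ext (a b : nat -> C) :
  (forall n, (1 <= n)%nat -> a n = b n) -> CSeries1 a = CSeries1 b.
Proof.
  intros H. unfold CSeries1, CSeries.
  f_equal; apply Series_ext; intros n; rewrite H by lia; reflexivity.
Qed.

Lemma csum_S_Re_Im (a : nat -> C) (n : nat) :
  csum a (S n) = (sum_n (fun k => Re (a (S k))) n, sum_n (fun k => Im (a (S k))) n).
Proof.
  rewrite <- (sum_n_Re_Im (fun k => a (S k))).
  induction n as [|n IH].
  - rewrite sum_O. simpl. ring.
  - rewrite sum_Sn, <- IH. reflexivity.
Qed.

(** A real majorant dominates both components, so the componentwise sum is the limit of the complex
    partial sums. *)
Lemma CSeries1_lim (a : nat -> C) (b : nat -> R) :
  ex_series b -> (forall n, Cmod (a (S n)) <= b n)%R ->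
  Clim (csum a) (CSeries1 a).
Proof.
  intros Hb Hab. apply is_lim_seq_incr_1.
  assert (Hre : ex_series (fun k => Re (a (S k)))).
  { apply (ex_series_le (V := R_CompleteNormedModule) _ b); [|exact Hb]. intros n.
    eapply Rle_trans; [apply re_le_Cmod|apply Hab]. }
  assert (Him : ex_series (fun k => Im (a (S k)))).
  { apply (ex_series_le (V := R_CompleteNormedModule) _ b); [|exact Hb]. intros n.
    eapply Rle_trans; [|apply Hab].
    eapply Rle_trans; [apply Rmax_r|apply Rmax_Cmod]. }
  apply Series_correct in Hre, Him.
  set (x := Series _) in Hre. set (y := Series _) in Him.
  apply is_lim_seq_0_le with (fun n =>
    (Rabs (sum_n (fun k => Re (a (S k))) n - x)
     + Rabs (sum_n (fun k => Im (a (S k))) n - y))%R).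
  - intros n. split; [apply Cmod_ge_0|]. rewrite csum_S_Re_Im.
    change (CSeries1 a) with (x, y).
    set (p := sum_n _ n). set (r := sum_n _ n).
    replace ((p, r) - (x, y)) with (RtoC (p - x)%R + Ci * RtoC (r - y)%R)
      by (apply injective_projections; simpl; ring).
    eapply Rle_trans; [apply Cmod_triangle|].
    rewrite Cmod_mult, Cmod_Ci, !Cmod_R. lra.
  - replace (Finite 0) with (Finite (Rabs (x - x) + Rabs (y - y)))
      by (f_equal; rewrite !Rminus_diag, Rabs_R0; ring).
    apply is_lim_seq_plus'; apply (is_lim_seq_abs _ (Finite _));
    apply is_lim_seq_minus'; auto using is_lim_seq_const.
Qed.

(** * Series dominated by a polynomial times a geometric sequence *)

(** Ratio test: consecutive terms have ratio [(1 + 1 / (n + 1))^k r], which tends to [r < 1]. *)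
Lemma ex_series_poly_geom (k : nat) (r : R) :
  (0 < r < 1)%R -> ex_series (fun n => INR (S n) ^ k * r ^ S n)%R.
Proof.
  intros Hr.
  assert (Hpos : forall n, (0 < INR (S n) ^ k * r ^ S n)%R).
  { intros n. apply Rmult_lt_0_compat; apply pow_lt; [apply lt_0_INR; lia|lra]. }
  apply ex_series_ext with (fun n => Rabs (INR (S n) ^ k * r ^ S n)).
  { intros n. apply Rabs_pos_eq, Rlt_le, Hpos. }
  apply ex_series_DAlembert with r; [lra|intros n; apply Rgt_not_eq, Hpos|].
  apply is_lim_seq_ext with (fun n => (1 + / INR (S n)) ^ k * r)%R.
  - intros n. rewrite Rabs_pos_eq.
    + assert (H0 : (0 < INR (S n))%R) by (apply lt_0_INR; lia).
      replace (1 + / INR (S n))%R with (INR (S (S n)) * / INR (S n))%R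
        by (rewrite (S_INR (S n)); field; lra).
      rewrite Rpow_mult_distr, pow_inv, <- (tech_pow_Rmult r (S n)).
      field. repeat split; apply pow_nonzero; lra.
    + apply Rlt_le, Rdiv_lt_0_compat; apply Hpos.
  - replace (Finite r) with (Finite (1 * r)) by (f_equal; ring).
    apply is_lim_seq_mult'; [|apply is_lim_seq_const].
    assert (L : is_lim_seq (fun n => 1 + / INR (S n))%R 1).
    { replace (Finite 1) with (Finite (1 + 0)) by (f_equal; ring).
      apply is_lim_seq_plus'; [apply is_lim_seq_const|].
      apply (is_lim_seq_incr_1 (fun n => / INR n)%R).
      apply (is_lim_seq_inv _ p_infty); [apply is_lim_seq_INR|easy]. }
    induction k as [|k IH]; simpl; [apply is_lim_seq_const|].
    replace (Finite 1) with (Finite (1 * 1)) by (f_equal; ring).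
    apply is_lim_seq_mult'; auto. apply IH. intros n.
    apply Rmult_lt_0_compat; apply pow_lt; [apply lt_0_INR; lia|lra].
Qed.

Lemma is_lim_seq_poly_geom (k : nat) (r : R) :
  (0 < r < 1)%R -> is_lim_seq (fun n => INR n ^ k * r ^ n)%R 0.
Proof.
  intros Hr. apply is_lim_seq_incr_1.
  apply ex_series_lim_0, ex_series_poly_geom, Hr.
Qed.

Definition poly_growth (g : nat -> R) : Prop :=
  exists (M : R) (k : nat),
    (0 <= M)%R /\ forall n, (1 <= n)%nat -> (Rabs (g n) <= M * INR n ^ k)%R.

Lemma CSeries1_poly_lim (a : nat -> C) (g : nat -> R) (c r : R) :
  poly_growth g -> (0 < r < 1)%R ->
  (forall n, (1 <= n)%nat -> Cmod (a n) <= Rabs (g n) * (c * r ^ n))%R ->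
  Clim (csum a) (CSeries1 a).
Proof.
  intros (M & k & HM & Hg) Hr Ha.
  apply CSeries1_lim with (fun n => (M * Rabs c) * (INR (S n) ^ k * r ^ S n))%R.
  - apply (ex_series_scal_l (K := R_AbsRing) (V := R_NormedModule) (M * Rabs c)%R (fun n => INR (S n) ^ k * r ^ S n)%R).
    now apply ex_series_poly_geom.
  - intros n. eapply Rle_trans; [apply Ha; lia|].
    assert (Hp : (0 <= r ^ S n)%R) by (apply pow_le; lra).
    apply Rle_trans with (Rabs (g (S n)) * (Rabs c * r ^ S n))%R.
    + apply Rmult_le_compat_l; [apply Rabs_pos|].
      apply Rmult_le_compat_r; [exact Hp|apply Rle_abs].
    + replace (M * Rabs c * (INR (S n) ^ k * r ^ S n))%R
        with (M * INR (S n) ^ k * (Rabs c * r ^ S n))%R by ring.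
      apply Rmult_le_compat_r; [|apply Hg; lia].
      apply Rmult_le_pos; [apply Rabs_pos|exact Hp].
Qed.

(** * Termwise complex differentiation *)

(** Summing the second-order remainders bounds [F z - F q - (z - q) * D] by [Series K] times
    [Cmod (z - q) ^ 2], which is little-o of [z - q]. *)
Lemma is_derive_termwise (f : nat -> C -> C) (F : C -> C) (d : nat -> C) (D q : C)
  (K : nat -> R) (delta : R) :
  (0 < delta)%R -> ex_series K ->
  (forall z, (Cmod (z - q) < delta)%R -> Clim (csum (fun n => f n z)) (F z)) ->
  Clim (csum d) D ->
  (forall n z, (Cmod (z - q) < delta)%R ->
     (Cmod (f (S n) z - f (S n) q - (z - q) * d (S n)) <= K n * Cmod (z - q) ^ 2)%R) ->
  is_derive (K := C_AbsRing) (V := C_NormedModule) F q D.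
Proof.
  intros Hdelta HK HF HD Hrem.
  (* Nonnegativity is forced by the remainder bound at a point other than [q], here
     [q + delta / 2]. *)
  assert (HK0 : forall n, (0 <= K n)%R).
  { intros n. specialize (Hrem n (q + RtoC (delta / 2))).
    replace (q + RtoC (delta / 2) - q) with (RtoC (delta / 2)) in Hrem by ring.
    rewrite Cmod_R, Rabs_pos_eq in Hrem by lra.
    assert (H := Rle_trans _ _ _ (Cmod_ge_0 _) (Hrem ltac:(lra))).
    assert (0 < (delta / 2) ^ 2)%R by (apply pow_lt; lra). nra. }
  assert (Hsum : forall n, (sum_n K n <= Series K)%R).
  { intros n. apply (is_lim_seq_incr_compare (sum_n K)).
    - exact (Series_correct K HK).
    - intros m. rewrite sum_Sn. change (plus ?x ?y) with (x + y)%R.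
      specialize (HK0 (S m)). lra. }
  assert (HKs : (0 <= Series K)%R).
  { eapply Rle_trans; [|apply (Hsum 0%nat)]. rewrite sum_O. apply HK0. }
  assert (Hq : (Cmod (q - q) < delta)%R).
  { replace (q - q) with (RtoC 0) by ring. now rewrite Cmod_0. }
  assert (Hbound : forall z, (Cmod (z - q) < delta)%R ->
    (Cmod (F z - F q - (z - q) * D) <= Series K * Cmod (z - q) ^ 2)%R).
  { intros z Hz.
    apply Clim_Cmod_le with
      (csum (fun n => f n z + -1 * f n q + (- (z - q)) * d n)).
    - replace (F z - F q - (z - q) * D) with (F z + -1 * F q + (- (z - q)) * D) by ring.
      apply Clim_ext with (fun n => csum (fun k => f k z) n
        + -1 * csum (fun k => f k q) n + (- (z - q)) * csum d n).
      + intros n. now rewrite !csum_plus, !csum_mult_l.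
      + repeat apply Clim_plus; try apply Clim_scal; auto.
    - intros [|n].
      + simpl. rewrite Cmod_0. apply Rmult_le_pos; [exact HKs|apply pow2_ge_0].
      + apply Rle_trans with (sum_n K n * Cmod (z - q) ^ 2)%R;
          [|apply Rmult_le_compat_r; [apply pow2_ge_0|apply Hsum]].
        induction n as [|n IH].
        * rewrite sum_O. simpl csum.
          replace (0 + (f 1%nat z + -1 * f 1%nat q + - (z - q) * d 1%nat))
            with (f 1%nat z - f 1%nat q - (z - q) * d 1%nat) by ring.
          now apply Hrem.
        * rewrite sum_Sn. change (plus ?x ?y) with (x + y)%R.
          rewrite Rmult_plus_distr_r.
          change (csum ?h (S ?m)) with (csum h m + h (S m)).
          eapply Rle_trans; [apply Cmod_triangle|].
          apply Rplus_le_compat; [exact IH|].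
          replace (f (S (S n)) z + -1 * f (S (S n)) q + - (z - q) * d (S (S n)))
            with (f (S (S n)) z - f (S (S n)) q - (z - q) * d (S (S n))) by ring.
          now apply Hrem. }
  split; [apply is_linear_scal_l|].
  intros x Hx eps.
  apply (is_filter_lim_locally_unique (V := AbsRing_NormedModule C_AbsRing)) in Hx. subst x.
  (* The [+ 1] keeps the denominator positive when the sum of [K] is 0. *)
  assert (Hpos : (0 < Rmin delta (eps / (Series K + 1)))%R).
  { apply Rmin_pos; [exact Hdelta|]. apply Rdiv_lt_0_compat; [apply cond_pos|lra]. }
  exists (mkposreal _ Hpos). intros z Hz.
  change (Cmod (z - q) < Rmin delta (eps / (Series K + 1)))%R in Hz.
  change (Cmod (F z - F q - (z - q) * D) <= eps * Cmod (z - q))%R.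
  assert (H1 := Rlt_le_trans _ _ _ Hz (Rmin_l _ _)).
  assert (H2 := Rlt_le_trans _ _ _ Hz (Rmin_r _ _)).
  eapply Rle_trans; [now apply Hbound|].
  apply (Rmult_lt_compat_r (Series K + 1)) in H2; [|lra].
  unfold Rdiv in H2. rewrite Rmult_assoc, Rinv_l, Rmult_1_r in H2 by lra.
  assert (H3 := Cmod_ge_0 (z - q)). nra.
Qed.

(** * The Lambert terms: product relation, size and Taylor remainder *)

Definition lambert (q : C) (n : nat) : C := q ^ n / (1 - q ^ n).

Lemma pow_le_self (r : R) (n : nat) :
  (0 <= r <= 1)%R -> (1 <= n)%nat -> (r ^ n <= r)%R.
Proof.
  intros Hr Hn. destruct n as [|n]; [lia|]. simpl.
  assert (H := pow_incr r 1 n ltac:(lra)). rewrite pow1 in H.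
  assert (H0 := pow_le r n ltac:(lra)). nra.
Qed.

Lemma Cmod_pow_le (q : C) (r : R) (n : nat) :
  (Cmod q <= r)%R -> (Cmod (q ^ n) <= r ^ n)%R.
Proof. intros H. rewrite Cmod_pow. apply pow_incr. split; [apply Cmod_ge_0|exact H]. Qed.

Lemma Cmod_1_plus_ge (w : C) : (1 - Cmod w <= Cmod (1 + w))%R.
Proof.
  assert (H := Cmod_triangle (1 + w) (- w)).
  replace (1 + w + - w) with (RtoC 1) in H by ring.
  rewrite Cmod_1, Cmod_opp in H. lra.
Qed.

(** Uniform in [n], because [r ^ n <= r] from [n = 1] on. *)
Lemma Cmod_1_plus_pow_ge (q : C) (r : R) (n : nat) :
  (Cmod q <= r)%R -> (r < 1)%R -> (1 <= n)%nat ->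
  (1 - r <= Cmod (1 + q ^ n))%R /\ (1 - r <= Cmod (1 - q ^ n))%R.
Proof.
  intros Hq Hr Hn. assert (H0 := Cmod_ge_0 q).
  assert (H1 := Cmod_pow_le q r n Hq).
  assert (H2 := pow_le_self r n ltac:(lra) Hn).
  assert (H3 := Cmod_1_plus_ge (q ^ n)).
  (* Here [potential4] is only a local name, for the bound at [- q ^ n]. *)
  assert (potential4 := Cmod_1_plus_ge (- q ^ n)). rewrite Cmod_opp in potential4.
  unfold Cminus. lra.
Qed.

Lemma one_plus_pow_neq_0 (q : C) (n : nat) :
  (Cmod q < 1)%R -> (1 <= n)%nat -> 1 + q ^ n <> 0 /\ 1 - q ^ n <> 0.
Proof.
  intros Hq Hn.
  destruct (Cmod_1_plus_pow_ge q (Cmod q) n (Rle_refl _) Hq Hn) as [H1 H2].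
  split; apply Cmod_gt_0; lra.
Qed.

Lemma Cmod_div_le (w v : C) (x y : R) :
  (0 < y)%R -> (Cmod w <= x)%R -> (y <= Cmod v)%R -> (Cmod (w / v) <= x / y)%R.
Proof.
  intros Hy Hw Hv.
  rewrite Cmod_div by (apply Cmod_gt_0; lra).
  apply Rmult_le_compat; [apply Cmod_ge_0| |exact Hw|].
  - apply Rlt_le, Rinv_0_lt_compat. lra.
  - now apply Rinv_le_contravar.
Qed.

(** With [x = q ^ a] and [y = q ^ b], the last factor is [(1 - x y) / ((1 - x) (1 - y))]. *)
Lemma lambert_mult (q : C) (a b : nat) :
  (Cmod q < 1)%R -> (1 <= a)%nat -> (1 <= b)%nat ->
  lambert q a * lambert q b = lambert q (a + b) * (lambert q a + lambert q b + 1).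
Proof.
  intros Hq Ha Hb. unfold lambert.
  assert (H := proj2 (one_plus_pow_neq_0 q (a + b) Hq ltac:(lia))).
  rewrite Cpow_add_r in *. field.
  repeat split; [now apply one_plus_pow_neq_0..|exact H].
Qed.

Lemma Cmod_lambert_le (q : C) (r : R) (n : nat) :
  (Cmod q <= r)%R -> (r < 1)%R -> (1 <= n)%nat ->
  (Cmod (lambert q n) <= / (1 - r) * r ^ n)%R.
Proof.
  intros Hq Hr Hn. rewrite Rmult_comm. apply Cmod_div_le; [lra|now apply Cmod_pow_le|].
  now apply Cmod_1_plus_pow_ge.
Qed.

Lemma Cmod_pow_sub_le (z q : C) (r : R) (m : nat) :
  (Cmod z <= r)%R -> (Cmod q <= r)%R ->
  (Cmod (z ^ S m - q ^ S m) <= INR (S m) * r ^ m * Cmod (z - q))%R.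
Proof.
  intros Hz Hq. assert (Hr := Rle_trans _ _ _ (Cmod_ge_0 q) Hq).
  induction m as [|m IH].
  - rewrite !Cpow_1_r. simpl. lra.
  - replace (z ^ S (S m) - q ^ S (S m))
      with (z * (z ^ S m - q ^ S m) + (z - q) * q ^ S m)
      by (rewrite (Cpow_S z (S m)), (Cpow_S q (S m)); ring).
    eapply Rle_trans; [apply Cmod_triangle|]. rewrite !Cmod_mult.
    apply Rle_trans with (r * (INR (S m) * r ^ m * Cmod (z - q)) + Cmod (z - q) * r ^ S m)%R.
    + apply Rplus_le_compat.
      * apply Rmult_le_compat; auto using Cmod_ge_0.
      * apply Rmult_le_compat_l; [apply Cmod_ge_0|now apply Cmod_pow_le].
    + rewrite (S_INR (S m)). simpl pow. apply Req_le. ring.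
Qed.

(** The factor [r] on the left avoids the exponent [m - 1] on the right. The remainder for [m + 1]
    is [q] times that for [m] plus [(z - q)] times a difference of powers, and
    [N^2 + N <= (N + 1)^2]. *)
Lemma Cmod_pow_taylor_le (z q : C) (r : R) (m : nat) :
  (Cmod z <= r)%R -> (Cmod q <= r)%R ->
  (r * Cmod (z ^ S m - q ^ S m - (z - q) * (INR (S m) * q ^ m))
   <= INR (S m) ^ 2 * r ^ m * Cmod (z - q) ^ 2)%R.
Proof.
  intros Hz Hq. assert (Hr := Rle_trans _ _ _ (Cmod_ge_0 q) Hq).
  assert (Hh := Cmod_ge_0 (z - q)).
  induction m as [|m IH].
  - replace (z ^ 1 - q ^ 1 - (z - q) * (INR 1 * q ^ 0)) with (RtoC 0) by (simpl; ring).
    rewrite Cmod_0, Rmult_0_r. simpl. nra.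
  - replace (z ^ S (S m) - q ^ S (S m) - (z - q) * (INR (S (S m)) * q ^ S m))
      with (q * (z ^ S m - q ^ S m - (z - q) * (INR (S m) * q ^ m))
            + (z - q) * (z ^ S m - q ^ S m))
      by (rewrite (S_INR (S m)), RtoC_plus,
            (Cpow_S z (S m)), (Cpow_S q (S m)), (Cpow_S q m); ring).
    set (w := z ^ S m - q ^ S m - _) in *.
    assert (Hd := Cmod_pow_sub_le z q r m Hz Hq).
    set (e := z ^ S m - q ^ S m) in *.
    assert (Ht := Cmod_triangle (q * w) ((z - q) * e)).
    rewrite !Cmod_mult in Ht.
    assert (Hn : (0 <= INR (S m))%R) by apply pos_INR.
    assert (Hp := pow_le r m Hr).
    set (h := Cmod (z - q)) in *. set (N := INR (S m)) in *.
    rewrite (S_INR (S m)). fold N.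
    apply Rle_trans with (r * (N ^ 2 * r ^ m * h ^ 2) + r * (h * (N * r ^ m * h)))%R.
    + apply Rle_trans with (r * (r * Cmod w) + r * (h * Cmod e))%R.
      * rewrite <- Rmult_plus_distr_l. apply Rmult_le_compat_l; [exact Hr|].
        assert (Cmod q * Cmod w <= r * Cmod w)%R
          by (apply Rmult_le_compat_r; [apply Cmod_ge_0|exact Hq]).
        lra.
      * apply Rplus_le_compat; apply Rmult_le_compat_l; auto.
        now apply Rmult_le_compat_l.
    + simpl (r ^ S m)%R.
      replace (r * (N ^ 2 * r ^ m * h ^ 2) + r * (h * (N * r ^ m * h)))%R
        with ((N ^ 2 + N) * (r * r ^ m * h ^ 2))%R by ring.
      rewrite (Rmult_assoc ((N + 1) ^ 2)). apply Rmult_le_compat_r; [|nra].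
      apply Rmult_le_pos; [now apply Rmult_le_pos|apply pow2_ge_0].
Qed.

Lemma Cmod_lambert_taylor_le (z q : C) (r : R) (m : nat) :
  (0 < r < 1)%R -> (Cmod z <= r)%R -> (Cmod q <= r)%R ->
  (Cmod (lambert z (S m) - lambert q (S m)
         - (z - q) * (INR (S m) * q ^ m / ((1 - q ^ S m) * (1 - q ^ S m))))
   <= (/ (r * (1 - r) ^ 2) + / (1 - r) ^ 3)
      * (INR (S m) ^ 2 * r ^ m * Cmod (z - q) ^ 2))%R.
Proof.
  intros Hr Hz Hq.
  destruct (Cmod_1_plus_pow_ge z r (S m) Hz (proj2 Hr) ltac:(lia)) as [_ Bz].
  destruct (Cmod_1_plus_pow_ge q r (S m) Hq (proj2 Hr) ltac:(lia)) as [_ Bq].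
  assert (Nz : 1 - z ^ S m <> 0) by (apply Cmod_gt_0; lra).
  assert (Nq : 1 - q ^ S m <> 0) by (apply Cmod_gt_0; lra).
  assert (T1 := Cmod_pow_taylor_le z q r m Hz Hq).
  assert (kernel2 := Cmod_pow_sub_le z q r m Hz Hq).
  assert (T3 := Cmod_pow_le q r m Hq).
  unfold lambert. set (c := INR (S m) * q ^ m) in *.
  assert (Hc : (Cmod c <= INR (S m) * r ^ m)%R).
  { unfold c. rewrite Cmod_mult, Cmod_R, Rabs_pos_eq by apply pos_INR.
    apply Rmult_le_compat_l; [apply pos_INR|exact T3]. }
  set (w := z ^ S m) in *. set (v := q ^ S m) in *.
  (* The difference of Lambert terms is [(w - v) / ((1 - w) (1 - v))]. The first summand is the
     Taylor remainder of the power, the second the error of replacing [1 - w] by [1 - v]; they give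
     the two constants in the bound. *)
  replace (w / (1 - w) - v / (1 - v) - (z - q) * (c / ((1 - v) * (1 - v))))
    with ((w - v - (z - q) * c) / ((1 - w) * (1 - v))
          + ((z - q) * c * (w - v)) / ((1 - w) * ((1 - v) * (1 - v))))
    by (field; auto).
  assert (Hp : (0 <= r ^ m <= 1)%R).
  { split; [apply pow_le; lra|]. rewrite <- (pow1 m). apply pow_incr. lra. }
  assert (Hh := Cmod_ge_0 (z - q)). set (h := Cmod (z - q)) in *.
  assert (HN := pos_INR (S m)). set (N := INR (S m)) in *.
  assert (Q2 : ((1 - r) ^ 2 <= Cmod ((1 - w) * (1 - v)))%R).
  { rewrite Cmod_mult. simpl pow. rewrite Rmult_1_r.
    apply Rmult_le_compat; lra. }
  assert (Q3 : ((1 - r) ^ 3 <= Cmod ((1 - w) * ((1 - v) * (1 - v))))%R).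
  { rewrite !Cmod_mult. simpl pow. rewrite Rmult_1_r.
    apply Rmult_le_compat; [lra|nra|lra|]. apply Rmult_le_compat; lra. }
  eapply Rle_trans; [apply Cmod_triangle|]. rewrite Rmult_plus_distr_r.
  apply Rplus_le_compat.
  - replace (/ (r * (1 - r) ^ 2) * (N ^ 2 * r ^ m * h ^ 2))%R
      with ((N ^ 2 * r ^ m * h ^ 2 / r) / (1 - r) ^ 2)%R by (field; lra).
    apply Cmod_div_le; [apply pow_lt; lra| |exact Q2].
    apply Rmult_le_reg_l with r; [lra|].
    replace (r * (N ^ 2 * r ^ m * h ^ 2 / r))%R with (N ^ 2 * r ^ m * h ^ 2)%R
      by (field; lra). exact T1.
  - rewrite Rmult_comm. apply Cmod_div_le; [apply pow_lt; lra| |exact Q3].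
    rewrite !Cmod_mult. fold h.
    apply Rle_trans with (h * (N * r ^ m) * (N * r ^ m * h))%R.
    + apply Rmult_le_compat; auto using Cmod_ge_0.
      * apply Rmult_le_pos; [exact Hh|apply Cmod_ge_0].
      * now apply Rmult_le_compat_l.
    + replace (h * (N * r ^ m) * (N * r ^ m * h))%R
        with (N ^ 2 * r ^ m * h ^ 2 * r ^ m)%R by ring.
      rewrite <- (Rmult_1_r (N ^ 2 * r ^ m * h ^ 2)) at 2.
      apply Rmult_le_compat_l; [|lra].
      repeat apply Rmult_le_pos; try apply pow2_ge_0; lra.
Qed.

Lemma Rlt_1_between (x : R) :
  (0 <= x < 1)%R -> exists r, (x < r < 1)%R.
Proof. intros H. exists ((x + 1) / 2)%R. lra. Qed.

(** * Lambert series with polynomially bounded coefficients, and their derivatives *)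

Lemma poly_growth_mult (f g : nat -> R) :
  poly_growth f -> poly_growth g -> poly_growth (fun n => f n * g n)%R.
Proof.
  intros (M & k & HM & Hf) (M' & k' & HM' & Hg).
  exists (M * M')%R, (k + k')%nat. split; [now apply Rmult_le_pos|].
  intros n Hn. rewrite Rabs_mult, pow_add.
  replace (M * M' * (INR n ^ k * INR n ^ k'))%R
    with ((M * INR n ^ k) * (M' * INR n ^ k'))%R by ring.
  apply Rmult_le_compat; auto using Rabs_pos.
Qed.

Lemma poly_growth_INR_pow (k : nat) : poly_growth (fun n => INR n ^ k)%R.
Proof.
  exists 1%R, k. split; [lra|]. intros n _.
  rewrite Rabs_pos_eq by apply pow_le, pos_INR. lra.
Qed.

Lemma poly_growth_INR : poly_growth INR.
Proof.
  destruct (poly_growth_INR_pow 1) as (M & k & HM & H).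
  exists M, k. split; [exact HM|]. intros n Hn. specialize (H n Hn).
  now rewrite pow_1 in H.
Qed.

Lemma poly_growth_bounded (g : nat -> R) (M : R) :
  (forall n, Rabs (g n) <= M)%R -> poly_growth g.
Proof.
  intros H. exists M, 0%nat.
  split; [eapply Rle_trans; [apply Rabs_pos|apply (H 0%nat)]|].
  intros n _. simpl. rewrite Rmult_1_r. apply H.
Qed.

Lemma lambert_lim (g : nat -> R) (q : C) :
  poly_growth g -> (Cmod q < 1)%R ->
  Clim (csum (fun n => g n * lambert q n)) (CSeries1 (fun n => g n * lambert q n)).
Proof.
  intros Hg Hq. assert (H0 := Cmod_ge_0 q).
  destruct (Rlt_1_between (Cmod q)) as [r Hr]; [lra|].
  apply CSeries1_poly_lim with g (/ (1 - r))%R r; [exact Hg|lra|].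
  intros n Hn. rewrite Cmod_mult, Cmod_R.
  apply Rmult_le_compat_l; [apply Rabs_pos|]. apply Cmod_lambert_le; auto; lra.
Qed.

Lemma lambert_deriv_lim (g : nat -> R) (q : C) :
  poly_growth g -> (Cmod q < 1)%R ->
  let a := fun n => RtoC (g n) *
    (INR n * q ^ (n - 1) / ((1 - q ^ n) * (1 - q ^ n))) in
  Clim (csum a) (CSeries1 a).
Proof.
  intros Hg Hq a. assert (H0 := Cmod_ge_0 q).
  destruct (Rlt_1_between (Cmod q)) as [r Hr]; [lra|].
  (* The factor [/ r] turns [r ^ (n - 1)] into [r ^ n]. *)
  apply CSeries1_poly_lim with (fun n => g n * INR n)%R (/ (r * (1 - r) ^ 2))%R r;
    [now apply poly_growth_mult; [|apply poly_growth_INR]|lra|].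
  intros [|m] Hn; [lia|]. unfold a.
  rewrite Nat.sub_succ, Nat.sub_0_r, Cmod_mult, Cmod_R, Rabs_mult, Rmult_assoc.
  apply Rmult_le_compat_l; [apply Rabs_pos|].
  replace (Rabs (INR (S m)) * (/ (r * (1 - r) ^ 2) * r ^ S m))%R
    with (Rabs (INR (S m)) * r ^ m / (1 - r) ^ 2)%R by (simpl (r ^ S m)%R; field; lra).
  destruct (Cmod_1_plus_pow_ge q r (S m) ltac:(lra) ltac:(lra) Hn) as [_ B].
  apply Cmod_div_le; [apply pow_lt; lra| |].
  - rewrite Cmod_mult, Cmod_R. apply Rmult_le_compat_l; [apply Rabs_pos|].
    apply Cmod_pow_le. lra.
  - rewrite Cmod_mult. simpl pow. rewrite Rmult_1_r. apply Rmult_le_compat; lra.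
Qed.

Lemma lambert_is_derive (g : nat -> R) (q : C) :
  poly_growth g -> (Cmod q < 1)%R ->
  is_derive (K := C_AbsRing) (V := C_NormedModule)
    (fun z => CSeries1 (fun n => g n * lambert z n)) q
    (CSeries1 (fun n => RtoC (g n) *
       (INR n * q ^ (n - 1) / ((1 - q ^ n) * (1 - q ^ n))))).
Proof.
  intros Hg Hq. assert (H0 := Cmod_ge_0 q).
  destruct (Rlt_1_between (Cmod q)) as [r Hr]; [lra|].
  (* The disc of radius [r - Cmod q] about [q] stays inside [Cmod z < r], where the bounds are
     uniform. *)
  assert (Hz : forall z, (Cmod (z - q) < r - Cmod q)%R -> (Cmod z < r)%R).
  { intros z Hz. replace z with ((z - q) + q) by ring.
    eapply Rle_lt_trans; [apply Cmod_triangle|]. lra. }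
  destruct (poly_growth_mult _ _ Hg (poly_growth_INR_pow 2)) as (M & k & HM & HgM).
  set (c := ((/ (r * (1 - r) ^ 2) + / (1 - r) ^ 3) / r)%R).
  assert (Hc : (0 <= c)%R).
  { unfold c. apply Rlt_le, Rdiv_lt_0_compat; [|lra].
    apply Rplus_lt_0_compat; apply Rinv_0_lt_compat;
      [apply Rmult_lt_0_compat; [lra|]|]; apply pow_lt; lra. }
  apply is_derive_termwise with (f := fun n z => g n * lambert z n)
    (d := fun n => RtoC (g n) * (INR n * q ^ (n - 1) / ((1 - q ^ n) * (1 - q ^ n))))
    (K := fun n => (c * M * (INR (S n) ^ k * r ^ S n))%R) (delta := (r - Cmod q)%R).
  - lra.
  - apply (ex_series_scal_l (K := R_AbsRing) (V := R_NormedModule) (c * M)%R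
      (fun n => INR (S n) ^ k * r ^ S n)%R).
    apply ex_series_poly_geom. lra.
  - intros z Hzq. apply lambert_lim; [exact Hg|]. specialize (Hz z Hzq). lra.
  - now apply lambert_deriv_lim.
  - intros m z Hzq. specialize (Hz z Hzq).
    rewrite Nat.sub_succ, Nat.sub_0_r.
    match goal with |- (Cmod ?x <= _)%R => replace x with (RtoC (g (S m)) *
      (lambert z (S m) - lambert q (S m)
         - (z - q) * (INR (S m) * q ^ m / ((1 - q ^ S m) * (1 - q ^ S m))))) by ring end.
    rewrite Cmod_mult, Cmod_R.
    assert (B := Cmod_lambert_taylor_le z q r m ltac:(lra) ltac:(lra) ltac:(lra)).
    apply (Rmult_le_compat_l (Rabs (g (S m)))) in B; [|apply Rabs_pos].
    eapply Rle_trans; [exact B|].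
    specialize (HgM (S m) ltac:(lia)). rewrite Rabs_mult in HgM.
    rewrite (Rabs_pos_eq (INR (S m) ^ 2)) in HgM by apply pow2_ge_0.
    replace (Rabs (g (S m)) * ((/ (r * (1 - r) ^ 2) + / (1 - r) ^ 3) *
               (INR (S m) ^ 2 * r ^ m * Cmod (z - q) ^ 2)))%R
      with ((Rabs (g (S m)) * INR (S m) ^ 2) * (c * r ^ S m * Cmod (z - q) ^ 2))%R
      by (unfold c; rewrite <- (tech_pow_Rmult r m); field; lra).
    replace (c * M * (INR (S m) ^ k * r ^ S m) * Cmod (z - q) ^ 2)%R
      with ((M * INR (S m) ^ k) * (c * r ^ S m * Cmod (z - q) ^ 2))%R by ring.
    apply Rmult_le_compat_r; [|exact HgM].
    apply Rmult_le_pos; [apply Rmult_le_pos; [exact Hc|apply pow_le; lra]|apply pow2_ge_0].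
Qed.

(** Termwise, [q] times the derivative is [n q^n / (1 - q^n)^2 = n (u_n + u_n^2)], the shape
    produced by the descent. *)
Lemma lambert_theta_deriv (g : nat -> R) (q : C) :
  poly_growth g -> (Cmod q < 1)%R ->
  Clim (csum (fun n => RtoC (INR n * g n)%R * (lambert q n + lambert q n * lambert q n)))
    (q * CSeries1 (fun n => RtoC (g n) *
       (INR n * q ^ (n - 1) / ((1 - q ^ n) * (1 - q ^ n))))).
Proof.
  intros Hg Hq.
  eapply Clim_ext; [|apply Clim_scal, (lambert_deriv_lim g q Hg Hq)].
  intros N. cbv beta. rewrite <- csum_mult_l. apply csum_ext. intros [|m] Hk; [lia|].
  rewrite Nat.sub_succ, Nat.sub_0_r, RtoC_mult. unfold lambert. rewrite Cpow_S.
  assert (Hn := proj2 (one_plus_pow_neq_0 q (S m) Hq ltac:(lia))).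
  rewrite Cpow_S in Hn. field. exact Hn.
Qed.

(** At most [n^2] pairs lie beyond the antidiagonal. There [a + b > n], so each term is at most
    [M n^k r^(n+1) / (1 - r)^2]. *)
Lemma corner_lim (H : nat -> nat -> R) (q : C) (M : R) (k : nat) :
  (Cmod q < 1)%R ->
  (forall n a b, (a <= n)%nat -> (b <= n)%nat -> Rabs (H a b) <= M * INR n ^ k)%R ->
  Clim (fun n => square_sum (fun a b => H a b * (lambert q a * lambert q b)) n
                 - triangle_sum (fun a b => H a b * (lambert q a * lambert q b)) n) 0.
Proof.
  intros Hq HM. assert (H0 := Cmod_ge_0 q).
  destruct (Rlt_1_between (Cmod q)) as [r Hr]; [lra|].
  set (c := (M * (r / (1 - r) ^ 2))%R).
  apply Clim_of_le with (fun n => c * (INR n ^ (2 + k) * r ^ n))%R.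
  2: { replace (Finite 0) with (Finite (c * 0)) by (f_equal; ring).
       apply is_lim_seq_mult'; [apply is_lim_seq_const|].
       apply is_lim_seq_poly_geom. lra. }
  intros n. set (K := fun a b => H a b * (lambert q a * lambert q b)).
  (* In column [b] the entries outside the triangle are [a = n - b + i] with [1 <= i <= b]. *)
  replace (square_sum K n - triangle_sum K n - 0)
    with (csum (fun b => csum (fun i => K (n - b + i)%nat b) b) n).
  2: { replace (square_sum K n) with
         (triangle_sum K n + csum (fun b => csum (fun i => K (n - b + i)%nat b) b) n); [ring|].
       unfold square_sum, triangle_sum. rewrite <- csum_plus. apply csum_ext. intros b Hb.
       rewrite <- (csum_split (fun a => K a b)). f_equal. lia. }
  assert (HMn : (0 <= M * INR n ^ k)%R).
  { eapply Rle_trans; [apply Rabs_pos|apply (HM n n n); lia]. }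
  set (B := (M * INR n ^ k * (/ (1 - r) ^ 2 * r ^ S n))%R).
  assert (HB : (0 <= B)%R).
  { apply Rmult_le_pos; [exact HMn|]. apply Rmult_le_pos; [|apply pow_le; lra].
    apply Rlt_le, Rinv_0_lt_compat, pow_lt. lra. }
  apply Rle_trans with (INR n * (INR n * B))%R.
  2: { unfold B, c. rewrite pow_add. simpl. apply Req_le. field. lra. }
  apply Cmod_csum_le. intros b Hb.
  apply Rle_trans with (INR b * B)%R.
  2: { apply Rmult_le_compat_r; [exact HB|]. apply le_INR. lia. }
  apply Cmod_csum_le. intros i Hi. unfold K.
  rewrite !Cmod_mult, Cmod_R.
  apply Rmult_le_compat; [apply Rabs_pos| |apply HM; lia|].
  { apply Rmult_le_pos; apply Cmod_ge_0. }
  apply Rle_trans with (/ (1 - r) * r ^ (n - b + i) * (/ (1 - r) * r ^ b))%R.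
  - apply Rmult_le_compat; try apply Cmod_ge_0; apply Cmod_lambert_le; try lra; lia.
  - replace (/ (1 - r) * r ^ (n - b + i) * (/ (1 - r) * r ^ b))%R
      with (/ (1 - r) ^ 2 * (r ^ (n - b + i) * r ^ b))%R by (field; lra).
    apply Rmult_le_compat_l; [apply Rlt_le, Rinv_0_lt_compat, pow_lt; lra|].
    rewrite <- pow_add. replace (n - b + i + b)%nat with (S n + (i - 1))%nat by lia.
    rewrite pow_add. rewrite <- (Rmult_1_r (r ^ S n)) at 2.
    apply Rmult_le_compat_l; [apply pow_le; lra|].
    rewrite <- (pow1 (i - 1)). apply pow_incr. lra.
Qed.

Lemma is_derive_affine (F : C -> C) (q D a b : C) :
  is_derive (K := C_AbsRing) (V := C_NormedModule) F q D ->
  is_derive (K := C_AbsRing) (V := C_NormedModule) (fun z => a + b * F z) q (b * D).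
Proof.
  intros H. rewrite <- (Cplus_0_l (b * D)).
  apply (is_derive_plus (K := C_AbsRing) (V := C_NormedModule)
           (fun _ => a) (fun z => b * F z)); [exact (is_derive_const (K := C_AbsRing) (V := C_NormedModule) a q)|].
  eapply filterdiff_ext_lin.
  - refine (filterdiff_scal_r_fct (U := AbsRing_NormedModule C_AbsRing) (V := C_NormedModule)
             b F _ Cmult_comm H).
  - intros y. simpl. change (b * (y * D) = y * (b * D)). ring.
Qed.

(** * The three functions as Lambert series *)

Lemma Rabs_sgn (n : nat) : Rabs (sgn n) = 1%R.
Proof. apply pow_1_abs. Qed.

Lemma alternating_lambert (q : C) (x : R) (n : nat) :
  (1 <= n)%nat ->
  RtoC (-1) ^ (n - 1) * RtoC x * q ^ n / (1 - q ^ n) = RtoC (- sgn n * x)%R * lambert q n.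
Proof.
  intros Hn. destruct n as [|m]; [lia|]. rewrite Nat.sub_succ, Nat.sub_0_r, sgn_S.
  rewrite <- RtoC_pow, Ropp_involutive, RtoC_mult. unfold lambert, sgn, Cdiv. ring.
Qed.

Lemma calP_lambert (q : C) :
  calP q = 1 + 8 * CSeries1 (fun n => RtoC (- sgn n * INR n)%R * lambert q n).
Proof.
  unfold calP. do 2 f_equal. apply CSeries1_ext. intros n Hn.
  now apply alternating_lambert.
Qed.

Lemma calQ_lambert (q : C) :
  calQ q = 1 + (-16) * CSeries1 (fun n => RtoC (- sgn n * INR n ^ 3)%R * lambert q n).
Proof.
  unfold calQ.
  rewrite (CSeries1_ext _ (fun n => RtoC (- sgn n * INR n ^ 3)%R * lambert q n)); [ring|].
  intros n Hn. rewrite <- (RtoC_pow (INR n)). now apply alternating_lambert.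
Qed.

Lemma poly_growth_sgn_pow (k : nat) : poly_growth (fun n => - sgn n * INR n ^ k)%R.
Proof.
  apply (poly_growth_mult (fun n => - sgn n)%R); [|apply poly_growth_INR_pow].
  apply poly_growth_bounded with 1%R. intros n. rewrite Rabs_Ropp, Rabs_sgn. lra.
Qed.

Lemma poly_growth_sgn_INR : poly_growth (fun n => - sgn n * INR n)%R.
Proof.
  apply (poly_growth_mult (fun n => - sgn n)%R); [|apply poly_growth_INR].
  apply poly_growth_bounded with 1%R. intros n. rewrite Rabs_Ropp, Rabs_sgn. lra.
Qed.

Lemma poly_growth_affine_sgn (a b : R) : poly_growth (fun n => (a + b * sgn n) * INR n)%R.
Proof.
  apply (poly_growth_mult (fun n => a + b * sgn n)%R); [|apply poly_growth_INR].
  apply poly_growth_bounded with (Rabs a + Rabs b)%R. intros n.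
  eapply Rle_trans; [apply Rabs_triang|]. rewrite Rabs_mult, Rabs_sgn. lra.
Qed.

(* Termwise, [q^n / (1 + q^n) = lambert q n - 2 * lambert q (2 * n)]. *)
Lemma csum_plus_lambert (q : C) (N : nat) :
  (Cmod q < 1)%R ->
  csum (fun n => INR n * q ^ n / (1 + q ^ n)) N
  = csum (fun n => INR n * lambert q n) N
    + -1 * csum (fun n => RtoC ((1 / 2 + 1 / 2 * sgn n) * INR n)%R * lambert q n) (2 * N).
Proof.
  intros Hq. induction N as [|N IH]; [simpl; ring|].
  replace (2 * S N)%nat with (S (S (2 * N))) by lia.
  change (csum ?h (S ?m)) with (csum h m + h (S m)). cbv beta.
  change (csum ?h (S ?m)) with (csum h m + h (S m)). cbv beta.
  rewrite IH.
  assert (E : sgn (2 * N) = 1%R).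
  { unfold sgn. rewrite pow_mult. replace ((-1) ^ 2)%R with 1%R by ring. apply pow1. }
  rewrite !sgn_S, E.
  (* The coefficient [(1 + sgn n) / 2] removes odd indices; at the even index [2 k] it leaves [2 k],
     the coefficient of [2 u_(2k)] taken [k] times. *)
  replace ((1 / 2 + 1 / 2 * - (1)) * INR (S (2 * N)))%R with 0%R by field.
  replace ((1 / 2 + 1 / 2 * - - (1)) * INR (S (S (2 * N))))%R with (2 * INR (S N))%R
    by (rewrite !S_INR, mult_INR; simpl; field).
  replace (S (S (2 * N))) with (S N + S N)%nat by lia.
  rewrite Cmult_0_l. unfold lambert. destruct (one_plus_pow_neq_0 q (S N) Hq ltac:(lia)) as [H1 H2].
  rewrite (Cpow_add_r q (S N) (S N)), RtoC_mult.
  set (w := q ^ S N) in *.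
  assert (H3 : 1 - w * w <> 0).
  { replace (1 - w * w) with ((1 + w) * (1 - w)) by ring. now apply Cmult_neq_0. }
  field. auto.
Qed.

(** Coefficientwise, [-8 sgn n - 24 + 12 (1 + sgn n) = -4 (3 - sgn n)]. *)
Lemma calP_sub_calE (q : C) :
  (Cmod q < 1)%R ->
  calP q - calE q = -4 * CSeries1 (fun n => RtoC ((3 + -1 * sgn n) * INR n)%R * lambert q n).
Proof.
  intros Hq. assert (H0 := Cmod_ge_0 q).
  destruct (Rlt_1_between (Cmod q)) as [r Hr]; [lra|].
  assert (LE : Clim (csum (fun n => INR n * q ^ n / (1 + q ^ n)))
                 (CSeries1 (fun n => INR n * q ^ n / (1 + q ^ n)))).
  { apply CSeries1_poly_lim with INR (/ (1 - r))%R r; [apply poly_growth_INR|lra|].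
    intros n Hn.
    replace (Rabs (INR n) * (/ (1 - r) * r ^ n))%R with (Rabs (INR n) * r ^ n / (1 - r))%R
      by (field; lra).
    destruct (Cmod_1_plus_pow_ge q r n ltac:(lra) ltac:(lra) Hn) as [B _].
    apply Cmod_div_le; [lra| |exact B]. rewrite Cmod_mult, Cmod_R.
    apply Rmult_le_compat_l; [apply Rabs_pos|apply Cmod_pow_le; lra]. }
  assert (LN := lambert_lim INR q poly_growth_INR Hq).
  assert (LH := lambert_lim _ q (poly_growth_affine_sgn (1 / 2) (1 / 2)) Hq).
  assert (LW := lambert_lim _ q (poly_growth_affine_sgn 3 (-1)) Hq).
  assert (LP := lambert_lim _ q poly_growth_sgn_INR Hq).
  set (W := CSeries1 (fun n => RtoC ((3 + -1 * sgn n) * INR n)%R * lambert q n)) in *.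
  unfold calE. set (E := CSeries1 (fun n => INR n * q ^ n / (1 + q ^ n))) in *.
  rewrite calP_lambert.
  set (A := CSeries1 (fun n => RtoC (- sgn n * INR n)%R * lambert q n)) in *.
  set (L1 := CSeries1 (fun n => INR n * lambert q n)) in *.
  set (L2 := CSeries1 (fun n => RtoC ((1 / 2 + 1 / 2 * sgn n) * INR n)%R * lambert q n)) in *.
  assert (HE : E = L1 + -1 * L2).
  (* The even-index series is followed along the subsequence [2 N] of its partial sums. *)
  { apply (Clim_unique _ _ _ LE).
    eapply Clim_ext; [intros N; symmetry; apply csum_plus_lambert, Hq|].
    apply Clim_plus; [exact LN|]. apply Clim_scal.
    refine (is_lim_seq_subseq _ _ (fun n => (2 * n)%nat) _ LH).
    apply eventually_subseq. intros n. lia. }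
  assert (HW : -4 * W = 8 * A + (-24) * L1 + 24 * L2).
  { apply (Clim_unique (fun N => -4 *
      csum (fun n => RtoC ((3 + -1 * sgn n) * INR n)%R * lambert q n) N)).
    - now apply Clim_scal.
    - eapply Clim_ext; [|apply Clim_plus;
        [apply Clim_plus; apply Clim_scal; [exact LP|exact LN]|apply Clim_scal; exact LH]].
      intros N. cbv beta. rewrite <- !csum_mult_l, <- !csum_plus. apply csum_ext.
      intros n _. rewrite ?RtoC_mult, ?RtoC_plus, ?RtoC_mult, ?RtoC_opp.
      unfold Rdiv. rewrite ?RtoC_mult, ?RtoC_inv by lra. field. }
  rewrite HW, HE. ring.
Qed.

(** * Polynomial bounds on the potentials *)

Lemma monomial_le (x y N : R) (i j : nat) :
  (0 <= x <= N)%R -> (0 <= y <= N)%R -> (0 <= x ^ i * y ^ j <= N ^ (i + j))%R.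
Proof.
  intros Hx Hy. rewrite pow_add. split.
  - apply Rmult_le_pos; apply pow_le; lra.
  - apply Rmult_le_compat; try (apply pow_le; lra); apply pow_incr; lra.
Qed.

(** The constant is [1 + 1 + 4], the 4 coming from [(a + b)^2 <= (2 n)^2]. *)
Lemma potential2_le (n a b : nat) :
  (a <= n)%nat -> (b <= n)%nat -> (Rabs (potential2 a b) <= 6 * INR n ^ 2)%R.
Proof.
  intros Ha Hb. apply le_INR in Ha, Hb.
  assert (Pa := pos_INR a). assert (Pb := pos_INR b).
  unfold potential2.
  assert (M1 := monomial_le (INR a) (INR b) (INR n) 2 0 ltac:(lra) ltac:(lra)).
  assert (M2 := monomial_le (INR a) (INR b) (INR n) 1 1 ltac:(lra) ltac:(lra)).
  assert (M3 := monomial_le (INR a) (INR b) (INR n) 0 2 ltac:(lra) ltac:(lra)).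
  simpl in *.
  apply Rabs_le. destruct (sgn_cases a) as [E|E], (sgn_cases b) as [F|F];
    rewrite E, F; lra.
Qed.

(** The coefficients of [potential4] have absolute values summing to at most 9.5, so 20 is ample. *)
Lemma potential4_le (n a b : nat) :
  (a <= n)%nat -> (b <= n)%nat -> (Rabs (potential4 a b) <= 20 * INR n ^ 4)%R.
Proof.
  intros Ha Hb. apply le_INR in Ha, Hb.
  assert (Pa := pos_INR a). assert (Pb := pos_INR b).
  unfold potential4.
  assert (M0 := monomial_le (INR a) (INR b) (INR n) 4 0 ltac:(lra) ltac:(lra)).
  assert (M1 := monomial_le (INR a) (INR b) (INR n) 3 1 ltac:(lra) ltac:(lra)).
  assert (M2 := monomial_le (INR a) (INR b) (INR n) 2 2 ltac:(lra) ltac:(lra)).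
  assert (M3 := monomial_le (INR a) (INR b) (INR n) 1 3 ltac:(lra) ltac:(lra)).
  assert (M4 := monomial_le (INR a) (INR b) (INR n) 0 4 ltac:(lra) ltac:(lra)).
  simpl in *.
  apply Rabs_le. destruct (sgn_cases a) as [E|E], (sgn_cases b) as [F|F];
    rewrite E, F; lra.
Qed.

Theorem theorem2p2 (q : C) (hq : (Cmod q < 1)%R) :
  (ex_derive (K := C_AbsRing) (V := C_NormedModule) calP q /\
   q * C_derive calP q = (calP q ^ 2 - calQ q) / 4) /\
  (ex_derive (K := C_AbsRing) (V := C_NormedModule) calQ q /\
   q * C_derive calQ q = calP q * calQ q - calE q * calQ q).
Proof.
  assert (Hu := fun a b => lambert_mult q a b hq).
  assert (LA := lambert_lim _ q poly_growth_sgn_INR hq).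
  assert (LB := lambert_lim _ q (poly_growth_sgn_pow 3) hq).
  assert (LW := lambert_lim _ q (poly_growth_affine_sgn 3 (-1)) hq).
  assert (dA := lambert_theta_deriv _ q poly_growth_sgn_INR hq).
  assert (dB := lambert_theta_deriv _ q (poly_growth_sgn_pow 3) hq).
  assert (DP := is_derive_affine _ _ _ 1 8
                  (lambert_is_derive _ q poly_growth_sgn_INR hq)).
  assert (DQ := is_derive_affine _ _ _ 1 (-16)
                  (lambert_is_derive _ q (poly_growth_sgn_pow 3) hq)).
  apply (is_derive_ext _ calP) in DP; [|intros z; symmetry; apply calP_lambert].
  apply (is_derive_ext _ calQ) in DQ; [|intros z; symmetry; apply calQ_lambert].
  split; (split; [eexists; eassumption|]).
  - rewrite (is_C_derive_unique _ _ _ DP), calP_lambert, calQ_lambert.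
    assert (C2 := corner_lim potential2 q 6 2 hq potential2_le).
    match type of LA with Clim _ ?x => set (A := x) in * end.
    match type of LB with Clim _ ?x => set (B := x) in * end.
    match type of dA with Clim _ (q * ?x) => set (A' := x) in * end.
    (* Limit of [descent2]; the corner contributes the term [-1 * 0]. *)
    assert (E : 4 * (A * A) + -1 * 0 = -1 * B + -1 * A + 2 * (q * A')).
    { refine (Clim_unique _ _ _ _ (Clim_plus _ _ _ _ (Clim_plus _ _ _ _
        (Clim_scal (-1) _ _ LB) (Clim_scal (-1) _ _ LA)) (Clim_scal 2 _ _ dA))).
      eapply Clim_ext; [|exact (Clim_plus _ _ _ _
        (Clim_scal 4 _ _ (Clim_mult _ _ _ _ LA LA)) (Clim_scal (-1) _ _ C2))].
      intros n. cbv beta.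
      match goal with |- ?x + RtoC (-1) * ?y = RtoC (-1) * ?z + RtoC (-1) * ?t + ?w =>
        transitivity (x - y); [ring|transitivity (- z - t + w); [|ring]] end.
      apply (descent2 (lambert q) Hu n). }
    replace (q * (8 * A')) with (4 * (2 * (q * A'))) by ring.
    replace (2 * (q * A')) with (4 * (A * A) + B + A); [field|].
    transitivity (4 * (A * A) + -1 * 0 + B + A); [ring|]. rewrite E. ring.
  (* Factoring out [calQ] leaves [calP - calE = -4 W], hence the right-hand side
     [-4 W (1 - 16 B) = 32 (2 W B - W / 8)]. *)
  - replace (calP q * calQ q - calE q * calQ q) with ((calP q - calE q) * calQ q) by ring.
    rewrite (is_C_derive_unique _ _ _ DQ), (calP_sub_calE q hq), calQ_lambert.
    assert (C4 := corner_lim potential4 q 20 4 hq potential4_le).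
    match type of LW with Clim _ ?x => set (W := x) in * end.
    match type of LB with Clim _ ?x => set (B := x) in * end.
    match type of dB with Clim _ (q * ?x) => set (B' := x) in * end.
    assert (E : 2 * (W * B) + 0 = 1 / 8 * W + - (1 / 2) * (q * B')).
    { refine (Clim_unique _ _ _ _ (Clim_plus _ _ _ _
        (Clim_scal (1 / 8) _ _ LW) (Clim_scal (- (1 / 2)) _ _ dB))).
      eapply Clim_ext; [|exact (Clim_plus _ _ _ _
        (Clim_scal 2 _ _ (Clim_mult _ _ _ _ LW LB)) C4)].
      intros n. cbv beta.
      match goal with |- _ = ?z + - (RtoC 1 / RtoC 2) * ?w =>
        transitivity (z - 1 / 2 * w); [|ring] end.
      apply (descent4 (lambert q) Hu n). }
    replace (q * (-16 * B')) with (32 * (- (1 / 2) * (q * B'))) by field.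
    replace (- (1 / 2) * (q * B')) with (2 * (W * B) - 1 / 8 * W); [field|].
    transitivity (2 * (W * B) + 0 - 1 / 8 * W); [ring|]. rewrite E. ring.
Qed.
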